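(* Let $m\ge 0$ and $n\ge 1$ be integers. Then $$\prod_{j=m+2}^{\infty}\left(\frac{\tan\!\left(2^{m-j}(2n-1)\pi\right)}{2^{m-j}(2n-1)\pi}\right)^{2^{j-1}}=\left(\frac{(2n-1)\pi}{2}\right)^{2^{m+1}} .$$
   Context: An infinite product $\prod_{j=m+2}^{\infty}c_j$ means $\lim_{M\to\infty}\prod_{j=m+2}^{M}c_j$. *)

(* Defs.v *)
From HB Require Import structures.
From mathcomp Require Import all_boot all_order all_algebra.
From mathcomp Require Import all_classical all_reals all_analysis.
Set Implicit Arguments.
Unset Strict Implicit.
Unset Printing Implicit Defensive.
Import Order.TTheory GRing.Theory Num.Theory.
Import numFieldNormedType.Exports.
Local Open Scope classical_set_scope.
Local Open Scope ring_scope.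

(* The infinite product over j >= a of c_j exists and equals l: the partial
   products over a <= j <= M, both ends included, converge to l. *)
Definition infinite_prod (R : realType) (a : nat) (c : nat -> R) (l : R) : Prop :=
  (fun M : nat => \prod_(a <= j < M.+1) c j) @ \oo --> l.

(* Main.v *)
Require Import Defs.
From HB Require Import structures.
From mathcomp Require Import all_boot all_order all_algebra.
From mathcomp Require Import all_classical all_reals all_analysis.
From mathcomp Require Import ring lra.
Set Implicit Arguments.
Unset Strict Implicit.
Unset Printing Implicit Defensive.
Import Order.TTheory GRing.Theory Num.Theory.
Import numFieldNormedType.Exports.
Local Open Scope classical_set_scope.
Local Open Scope ring_scope.

(** With [sinc x = sin x / x], the double angle formula gives
    [tan x / x = sinc x ^ 2 / sinc (2 x)].  Hence the product of
    [(tan (y / 2^k.+1) / (y / 2^k.+1)) ^ 2^k] over [k < N] telescopes to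
    [sinc (y / 2^N) ^ 2^N / sinc y], and [1 - x^2 / 2 <= sinc x <= 1] with
    Bernoulli's inequality sends the numerator to [1].  The limit [y / sin y] at
    [y = (2n-1) pi / 2], where [sin y = 1] or [-1], raised to the power
    [2^(m+1)], is the claim. *)

Definition sinc (R : realType) (x : R) : R := sin x / x.

Lemma bernoulli_ineq (R : realDomainType) (x : R) (n : nat) :
  -1 <= x -> 1 + n%:R * x <= (1 + x) ^+ n.
Proof.
move=> x1; elim: n => [|n IHn]; first by rewrite expr0 mul0r addr0.
have x10 : 0 <= 1 + x by lra.
rewrite exprSr; apply: le_trans (ler_wpM2r x10 IHn).
by rewrite -natr1; have := mulr_ge0 (ler0n R n) (sqr_ge0 x); lra.
Qed.

(** The mean value theorem for [sin] on [0, x]; the upper and the lower bound on [sinc] both follow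
    from it. *)
Lemma sinc_MVT (R : realType) (x : R) :
  0 < x -> exists2 c, 0 < c < x & sinc x = cos c.
Proof.
move=> x0.
have [|c] := @MVT R sin cos 0 x x0 (fun y _ => is_derive_sin y).
  by apply: continuous_subspaceT => y; exact: continuous_sin.
rewrite in_itv/= sin0 !subr0 => cx sinE; exists c => //.
by rewrite /sinc sinE mulfK// gt_eqF.
Qed.

Lemma sinc_le1 (R : realType) (x : R) : 0 < x -> sinc x <= 1.
Proof. by move=> /sinc_MVT[c _ ->]; exact: cos_le1. Qed.

Lemma sqr_sin_le (R : realType) (x : R) : 0 < x -> sin x ^+ 2 <= x ^+ 2.
Proof.
move=> x0; have [c _ sincE] := sinc_MVT x0.
have -> : sin x = x * cos c by rewrite -sincE /sinc mulrC divfK// gt_eqF.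
by rewrite exprMn ler_piMr ?sqr_ge0 ?cos2sin2 ?gerBl ?sqr_ge0.
Qed.

(** For the mean value point [c], cos c = 1 - 2 sin(c/2)^2 >= 1 - c^2/2, and c < x. *)
Lemma sinc_ge (R : realType) (x : R) : 0 < x -> 1 - x ^+ 2 / 2 <= sinc x.
Proof.
move=> x0; have [c /andP[c0 cx] ->] := sinc_MVT x0.
have -> : cos c = 1 - sin (c / 2) ^+ 2 * 2.
  have {1}-> : c = (c / 2) *+ 2 by rewrite mulr2n; field.
  by rewrite cos_mulr2n; have := cos2Dsin2 (c / 2); lra.
have c20 : 0 < c / 2 by lra.
have := sqr_sin_le c20; have : c ^+ 2 <= x ^+ 2 by rewrite ler_sqr ?nnegrE; lra.
by rewrite exprMn exprVn; lra.
Qed.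

Lemma tan_div_sinc (R : realType) (x : R) :
  sin (x *+ 2) != 0 -> tan x / x = sinc x ^+ 2 / sinc (x *+ 2).
Proof.
(* As sin 2x = 2 sin x cos x is nonzero, so are [x], [sin x] and [cos x], and every division is
   genuine. *)
rewrite /tan /sinc sin_mulr2n => s2.
have x0 : x != 0 by apply: contra_neq s2 => ->; rewrite sin0 mulr0 mul0rn.
have [c0 s0] : cos x != 0 /\ sin x != 0.
  by split; apply: contra_neq s2 => ->; rewrite ?mul0r ?mulr0 mul0rn.
by field; rewrite x0 c0 s0.
Qed.

Lemma sin_half_neq0 (R : realType) (x : R) : sin x != 0 -> sin (x / 2) != 0.
Proof.
move=> sx; apply: contra_neq sx => s0.
have -> : x = (x / 2) *+ 2 by rewrite mulr2n; field.
by rewrite sin_mulr2n s0 mulr0 mul0rn.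
Qed.

Lemma sin_dyadic_neq0 (R : realType) (x : R) (n : nat) :
  sin x != 0 -> sin (x / 2 ^+ n) != 0.
Proof.
move=> sx; elim: n => [|n /sin_half_neq0]; first by rewrite expr0 divr1.
by rewrite exprSr invfM mulrA.
Qed.

Lemma sinc_neq0 (R : realType) (x : R) : sin x != 0 -> sinc x != 0.
Proof.
move=> sx; rewrite /sinc mulf_neq0// invr_eq0.
by apply: contra_neq sx => ->; rewrite sin0.
Qed.

Lemma prod_tan_dyadic (R : realType) (y : R) (N : nat) : sin y != 0 ->
  \prod_(0 <= k < N) (tan (y / 2 ^+ k.+1) / (y / 2 ^+ k.+1)) ^+ (2 ^ k) =
  sinc (y / 2 ^+ N) ^+ (2 ^ N) / sinc y.
Proof.
(* The factor of index [k] is [g k.+1 / g k]. *)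
move=> sy; pose g k := sinc (y / 2 ^+ k) ^+ (2 ^ k).
have g0 k : g k != 0 by rewrite expf_neq0// sinc_neq0// sin_dyadic_neq0.
case: N => [|N].
  by rewrite big_nil expr0 divr1 expn0 expr1 divff// sinc_neq0.
rewrite (@telescope_prodf_eq _ _ _ g)//; first by rewrite {2}/g expr0 divr1.
move=> k _; rewrite /g.
have dbl : (y / 2 ^+ k.+1) *+ 2 = y / 2 ^+ k.
  by rewrite exprSr invfM mulr2n; field; rewrite expf_neq0.
rewrite tan_div_sinc; last by rewrite dbl sin_dyadic_neq0.
by rewrite dbl expr_div_n -exprM expnS.
Qed.

Lemma cvg_sinc_dyadic (R : realType) (y : R) : 0 < y ->
  sinc (y / 2 ^+ N) ^+ (2 ^ N) @[N --> \oo] --> (1 : R).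
Proof.
move=> y0.
have cvg0 : (y ^+ 2 / 2 * 2^-1 ^+ N : R) @[N --> \oo] --> (0 : R).
  rewrite -[X in _ --> X](mulr0 (y ^+ 2 / 2)); apply: cvgMr.
  by apply: cvg_expr; rewrite ger0_norm; lra.
have cvg1 : (1 - y ^+ 2 / 2 * 2^-1 ^+ N : R) @[N --> \oo] --> (1 : R).
  by rewrite -[X in _ --> X]subr0; apply: cvgB => //; exact: cvg_cst.
apply: (@squeeze_cvgr _ _ _ _ _ (fun=> 1) _ _ _ cvg1); last exact: cvg_cst.
(* Eventually x^2/2 <= 1 for x = y/2^N: then 1 - x^2/2 is nonnegative, so Bernoulli applies and
   powers preserve the bound. *)
have small : \forall N \near \oo, y ^+ 2 / 2 * 2^-1 ^+ N < (1 : R).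
  by apply: (cvgr_lt (0 : R)) => //; exact: ltr01.
near=> N.
have x0 : 0 < y / 2 ^+ N by rewrite divr_gt0 ?exprn_gt0.
set x := y / 2 ^+ N in x0 *.
(* Bernoulli's factor 2^N cancels only one of the two factors 2^-N in x^2, so the error still tends
   to 0. *)
have xE : (2 ^ N)%:R * (x ^+ 2 / 2) = y ^+ 2 / 2 * 2^-1 ^+ N.
  by rewrite natrX /x exprVn; field; rewrite expf_neq0.
have x1 : x ^+ 2 / 2 <= 1.
  apply: (@le_trans _ _ ((2 ^ N)%:R * (x ^+ 2 / 2))).
    rewrite ler_peMl ?divr_ge0 ?sqr_ge0// natrX exprn_ege1//; lra.
  by rewrite xE ltW//; near: N.
have sx : 0 <= sinc x by apply: le_trans (sinc_ge x0); lra.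
apply/andP; split; last by rewrite exprn_ile1 ?sinc_le1.
rewrite -xE -mulrN.
apply: le_trans (bernoulli_ineq _ _) _; first by lra.
by rewrite lerXn2r ?nnegrE ?sinc_ge//; lra.
Unshelve. all: by end_near. Qed.

Lemma cvg_prod_tan_dyadic (R : realType) (y : R) : 0 < y -> sin y != 0 ->
  \prod_(0 <= k < N) (tan (y / 2 ^+ k.+1) / (y / 2 ^+ k.+1)) ^+ (2 ^ k)
    @[N --> \oo] --> y / sin y.
Proof.
move=> y0 sy; under eq_fun do rewrite prod_tan_dyadic//.
have -> : y / sin y = 1 / sinc y by rewrite /sinc div1r invf_div.
by apply: cvgMl; exact: cvg_sinc_dyadic.
Qed.

(** Raising [n] by one shifts the argument by [pi], which flips the sign of [sin]; the square
    absorbs it. *)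
Lemma sqr_sin_odd_pihalf (R : realType) (n : nat) :
  sin ((2 * n%:R - 1) * pi / 2 : R) ^+ 2 = 1.
Proof.
elim: n => [|n IHn].
  by rewrite mulr0 sub0r mulN1r mulNr sinN sin_pihalf sqrrN expr1n.
rewrite -[RHS]IHn -[RHS]sqrrN -sinDpi; congr (sin _ ^+ 2).
by rewrite -natr1; field.
Qed.

Theorem mainTheorem2 (R : realType) (m n : nat) (hn : (1 <= n)%N) :
  infinite_prod (m + 2)
    (fun j : nat =>
       (tan ((2 : R) ^ (m%:Z - j%:Z) * (2 * n%:R - 1) * pi)
          / ((2 : R) ^ (m%:Z - j%:Z) * (2 * n%:R - 1) * pi)) ^+ (2 ^ (j - 1))%N)
    (((2 * n%:R - 1) * pi / 2) ^+ (2 ^ (m + 1))%N).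
Proof.
set y := (2 * n%:R - 1) * pi / 2.
have y0 : 0 < y.
  have n1 : (1 : R) <= n%:R by rewrite ler1n.
  by rewrite divr_gt0// mulr_gt0 ?pi_gt0//; lra.
have sy2 : sin y ^+ 2 = 1 := sqr_sin_odd_pihalf R n.
have sy : sin y != 0 by rewrite -sqrf_eq0 sy2 oner_eq0.
(* With M = N + m + 1, the range m + 2 <= j <= M holds exactly [N] factors. *)
rewrite /infinite_prod -(cvg_shiftn (m + 1)).
(* The exponent is even, so the sign of [sin y] disappears. *)
have -> : y ^+ (2 ^ (m + 1)) = (y / sin y) ^+ (2 ^ (m + 1)).
  by rewrite [RHS]expr_div_n addn1 expnS [sin y ^+ _]exprM sy2 expr1n divr1.
rewrite [X in X @ _ --> _](_ : _ = fun N => (\prod_(0 <= k < N)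
  (tan (y / 2 ^+ k.+1) / (y / 2 ^+ k.+1)) ^+ (2 ^ k)) ^+ (2 ^ (m + 1))).
  exact: (cvg_comp _ _ (cvg_prod_tan_dyadic y0 sy) (@exprn_continuous R _ _)).
apply/funext => N.
rewrite /= -prodrXl -addnS -{1}[(m + 2)%N]add0n.
have -> : (N + (m + 1).+1)%N = (N + (m + 2))%N by rewrite !addn1 addn2.
rewrite big_addn addnK; apply: eq_bigr => k _.
(* For j = k + m + 2 the power of 2 is 2^-(k+2), and [y] already contains one of these halves. *)
have -> : (2 : R) ^ (m%:Z - (k + (m + 2))%N%:Z) * (2 * n%:R - 1) * pi =
          y / 2 ^+ k.+1.
  have -> : (m%:Z - (k + (m + 2))%N%:Z = - (k.+2)%:Z).
    by rewrite !PoszD -addn2 PoszD; ring.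
  by rewrite -exprnN /y !exprS; field; rewrite expf_neq0.
(* The exponents agree since j - 1 = k + (m + 1). *)
rewrite -exprM -expnD; congr (_ ^+ (2 ^ _)).
by rewrite addn2 addnS subn1 addn1.
Qed.
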